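(* Let $G$ be a finite undirected bipartite graph (possibly with multiple edges) with nonempty vertex set $V$ and edge set $E$, and let $b\in\mathbb{R}^V$ have all entries nonnegative. Then an element $u$ of $\mathcal{P}(G,b)$ is a vertex of the polytope $\mathcal{P}(G,b)$ if and only if the graph $\mathrm{gr}(u)$ of $u$ is a forest.
   Context: $\delta_G(v)$ denotes the set of edges of $G$ incident with $v$. $\mathcal{P}(G,b)=\{x\in\mathbb{R}^E \mid x_e\ge 0 \text{ for each } e\in E,\ \sum_{e\in\delta_G(v)}x_e=b_v \text{ for each } v\in V\}$ (when $E=\emptyset$, $\mathbb{R}^\emptyset=\{0\}$, so it is $\{0\}$ if $b=0$ and $\emptyset$ otherwise). For $x\in\mathcal{P}(G,b)$, the graph $\mathrm{gr}(x)$ of $x$ is the spanning subgraph of $G$ (vertex set $V$) with edge set $\{e\in E\mid x_e>0\}$. Two distinct vertices together with two distinct edges connecting them form a cycle of length 2 (so a forest has no multiple edges). *)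

(* Defs.v *)
From HB Require Import structures.
From mathcomp Require Import all_boot all_order all_algebra.
From mathcomp Require Import classical_sets reals.

Set Implicit Arguments.
Unset Strict Implicit.
Unset Printing Implicit Defensive.

Import Order.TTheory GRing.Theory Num.Theory.
Local Open Scope ring_scope.

(* Edges are abstract objects, so parallel edges are allowed; [ends e] is the
   set of endpoints of [e], a singleton exactly when [e] is a loop. *)
Record multigraph (V E : finType) := Multigraph {
  ends : E -> {set V};
  ends_card : forall e, (0 < #|ends e| <= 2)%N
}.

Definition incident_edges (V E : finType) (G : multigraph V E) (v : V) :
  {set E} := [set e | v \in ends G e].

Definition bipartite (V E : finType) (G : multigraph V E) : Prop :=
  exists A : {set V}, forall e : E,
    exists a b : V, [/\ a \in A, b \notin A & ends G e = [set a; b]].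

Definition spanning_subgraph (V E : finType) (G : multigraph V E)
    (F : pred E) : multigraph V {e : E | F e} :=
  Multigraph (fun e => ends_card G (val e)).

(* A cycle of length [n.+1]: [c i] connects [v i] to its cyclic successor.
   Length 1 is a loop and length 2 is a pair of distinct parallel edges. *)
Definition is_cycle (V E : finType) (G : multigraph V E) (n : nat)
    (v : 'I_n.+1 -> V) (c : 'I_n.+1 -> E) : Prop :=
  [/\ injective v, injective c &
      forall i, ends G (c i) = [set v i; v (ordS i)]].

Definition forest (V E : finType) (G : multigraph V E) : Prop :=
  forall (n : nat) (v : 'I_n.+1 -> V) (c : 'I_n.+1 -> E), ~ is_cycle G v c.

(* [R^o] is [R] as a module over itself; it makes [{ffun E -> R^o}] the vector
   space of real vectors indexed by [E]. *)
Definition bmatching_polytope (R : realType) (V E : finType)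
    (G : multigraph V E) (b : {ffun V -> R}) : set {ffun E -> R^o} :=
  [set x : {ffun E -> R^o} |
    (forall e, 0 <= x e) /\
    (forall v, \sum_(e in incident_edges G v) x e = b v)]%classic.

(* Vertices are taken as extreme points. *)
Definition polytope_vertex (R : realType) (W : lmodType R) (P : set W)
    (u : W) : Prop :=
  P u /\ forall (x y : W) (t : R), P x -> P y -> 0 < t < 1 ->
    u = t *: x + (1 - t) *: y -> x = u /\ y = u.

Definition gr (R : realType) (V E : finType) (G : multigraph V E)
    (x : {ffun E -> R^o}) : multigraph V {e : E | 0 < x e} :=
  spanning_subgraph G (fun e => 0 < x e).

(* Main.v *)
(** The difference of two points of the polytope is a circulation: an edge
    vector whose sum over the edges at each vertex is 0.  In a bipartite graph,
    giving each edge of a cycle, traversed in a fixed direction, the sign of the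
    side of its tail yields a nonzero circulation d; if the cycle lies in gr(u),
    then u is the midpoint of the feasible points u + eps d and u - eps d.
    Conversely, if u = t x + (1 - t) y, then x - u is a circulation supported in
    gr(u).  A nonempty set of edges of a forest has a leaf, and a circulation
    vanishes on a leaf edge of its support, so x = u. *)
Require Import Defs.
From mathcomp Require Import all_boot all_order all_algebra.
From mathcomp Require Import classical_sets reals.
From mathcomp Require Import zify lra.
Import Order.TTheory GRing.Theory Num.Theory.
Local Open Scope ring_scope.

Set Implicit Arguments.
Unset Strict Implicit.

Lemma ends_other (V E : finType) (G : multigraph V E) (e : E) (a : V) :
  a \in ends G e -> exists x, ends G e = [set a; x].
Proof.
move=> ae; have /andP[_] := ends_card G e; rewrite (cardsD1 a) ae add1n ltnS.
case: (set_0Vmem (ends G e :\ a)) => [e0 _|[x xe] le1].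
  (* Case of a loop: [a] is its own other end. *)
  by exists a; rewrite -(finset.setD1K ae) e0 finset.setU0 finset.setUid.
exists x; rewrite -(finset.setD1K ae); congr (_ |: _).
by apply/esym/eqP; rewrite eqEcard finset.sub1set xe cards1.
Qed.

(* The first return of a walk to a vertex already visited closes a cycle; its
   edges are distinct because the walk never immediately reuses an edge. *)
Lemma walk_cycle (V E : finType) (G : multigraph V E)
    (e : nat -> E) (v : nat -> V) :
  (forall k, ends G (e k.+1) = [set v k; v k.+1]) ->
  (forall k, e k.+1 != e k) -> ~ forest G.
Proof.
move=> ends_e e_neq.
have ex_rep : exists j, [exists i : 'I_j, v i == v j].
  have /injectivePn[i [k neq_ik vik]] :
      ~~ injectiveb (fun i : 'I_#|V|.+1 => v i).
    apply/negP => /injectiveP /leq_card; rewrite card_ord; lia.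
  have [ik|ki|/val_inj ik] := ltngtP i k; last by rewrite ik eqxx in neq_ik.
    by exists k; apply/existsP; exists (Ordinal ik); apply/eqP.
  by exists i; apply/existsP; exists (Ordinal ki); apply/eqP.
case: (ex_minnP ex_rep) => j /existsP[[i ij] /= /eqP vij] j_min.
have v_inj k l : (k < l)%N -> (l < j)%N -> v k != v l.
  move=> kl lj; apply/negP => vkl.
  suff: (j <= l)%N by lia.
  by apply: j_min; apply/existsP; exists (Ordinal kl).
have [n jE] : exists n, j = (i + n.+1)%N by exists (j - i).-1; lia.
move=> /(_ n (fun k => v (i + k)%N) (fun k => e (i + k).+1)); apply; split.
- move=> k l vkl; apply: val_inj; have := ltn_ord k; have := ltn_ord l.
  move=> ln kn; have [kl|lk|//] := ltngtP k l.
    by have := v_inj (i + k)%N (i + l)%N; rewrite vkl eqxx; lia.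
  by have := v_inj (i + l)%N (i + k)%N; rewrite vkl eqxx; lia.
- suff e_inj k l : (k < l)%N -> (l < j)%N -> e k.+1 != e l.+1.
    move=> k l ekl; apply: val_inj; have := ltn_ord k; have := ltn_ord l.
    move=> ln kn; have [kl|lk|//] := ltngtP k l.
      by have := e_inj (i + k)%N (i + l)%N; rewrite ekl eqxx; lia.
    by have := e_inj (i + l)%N (i + k)%N; rewrite ekl eqxx; lia.
  move=> kl lj; apply/negP => /eqP ekl.
  (* If edges [k.+1] and [l.+1] coincide, [v l] is [v k] or [v k.+1]; as [j] is the first return,
     only [l = k.+1] is possible, which is an immediate reuse. *)
  have : v l \in ends G (e k.+1) by rewrite ekl ends_e set21.
  rewrite ends_e !inE eq_sym (negPf (v_inj _ _ kl lj)) /= => /eqP vl.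
  move: kl; rewrite leq_eqVlt => /orP[/eqP lE|kl].
    by have := e_neq k.+1; rewrite {1}lE -ekl eqxx.
  by have := v_inj _ _ kl lj; rewrite vl eqxx.
- move=> k; rewrite ends_e /=; congr [set _; _].
  have [kn|nk] := ltnP k n; first by rewrite modn_small ?addnS // ltnS.
  have -> : k = n :> nat by have := ltn_ord k; lia.
  by rewrite modnn addn0 -addnS -jE vij.
Qed.

(** If no vertex meets exactly one edge of [F], a walk in [F] never gets stuck: wherever it arrives,
    a second edge of [F] leads on. Such an endless walk closes a cycle. *)
Lemma forest_leaf (V E : finType) (G : multigraph V E) (F : {set E}) :
  forest G -> F != finset.set0 -> exists v e, incident_edges G v :&: F = [set e].
Proof.
move=> forestG /finset.set0Pn[e0 e0F].
case: (boolP [exists v, #|incident_edges G v :&: F| == 1%N]).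
  by move=> /existsP[v /cards1P[e ve]]; exists v, e.
rewrite negb_exists => /forallP no_leaf; exfalso.
(* A dart is an edge of [F] with the end at which the walk arrives. *)
pose dart (p : E * V) := (p.1 \in F) && (p.2 \in ends G p.1).
pose step p q := [&& dart q, q.1 != p.1 & ends G q.1 == [set p.2; q.2]].
have ex_step p : dart p -> exists q, step p q.
  case: p => e a /andP[/= eF ae].
  have ein : e \in incident_edges G a :&: F by rewrite !inE ae.
  have := no_leaf a; rewrite (cardsD1 e) ein add1n eqSS cards_eq0.
  case/finset.set0Pn => e'; rewrite !inE => /and3P[e'e ae' e'F].
  have [x e'E] := ends_other ae'.
  by exists (e', x); rewrite /step /dart /= e'F e'e e'E set22 eqxx.
(* The default [p] is never reached on a dart, by [ex_step]. *)
pose next p := odflt p [pick q | step p q].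
have nextP p : dart p -> step p (next p).
  rewrite /next => /ex_step[q pq]; case: pickP => //= /(_ q).
  by rewrite pq.
have /andP[/card_gt0P[a0 a0e] _] := ends_card G e0.
pose w k := iter k next (e0, a0).
have dart_w k : dart (w k).
  elim: k => [|k IHk]; first by rewrite /dart /= e0F.
  by case/and3P: (nextP _ IHk).
apply: (@walk_cycle _ _ G (fun k => (w k).1) (fun k => (w k).2) _ _ forestG) => k.
  by case/and3P: (nextP _ (dart_w k)) => _ _ /eqP.
by case/and3P: (nextP _ (dart_w k)).
Qed.

Lemma cycle_circulation (R : numDomainType) (V E : finType)
    (G : multigraph V E) (n : nat) (v : 'I_n.+1 -> V) (c : 'I_n.+1 -> E) :
  bipartite G -> is_cycle G v c ->
  exists d : E -> R,
    [/\ forall w, \sum_(e in incident_edges G w) d e = 0,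
        forall i, `|d (c i)| = 1 & forall e, e \notin codom c -> d e = 0].
Proof.
move=> [A bipA] [v_inj c_inj ends_c].
pose s (x : V) : R := if x \in A then 1 else -1.
have sides i : (v i \in A) = (v (ordS i) \notin A).
  have [a [b [aA bA cE]]] := bipA (c i); move: cE; rewrite ends_c => cE.
  have := set21 (v i) (v (ordS i)); rewrite cE => /set2P[vi|vi].
    have := set22 a b; rewrite -cE vi => /set2P[ba|<-].
      by rewrite ba aA in bA.
    by rewrite aA bA.
  have := set21 a b; rewrite -cE vi => /set2P[ab|<-].
    by rewrite -ab aA in bA.
  by rewrite aA (negPf bA).
have sS i : s (v (ordS i)) = - s (v i).
  by rewrite /s (sides i); case: (_ \in A); rewrite //= opprK.
(* By injectivity of [c] the sum has at most one term; it is empty off the cycle. *)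
exists (fun e => \sum_(i | c i == e) s (v i)); split.
- move=> w; rewrite (exchange_big_dep xpredT) //=.
  (* Edge [c i] contributes [s] of its tail, which is minus [s] of its head. Over the cycle, the
     tail terms and head terms agree up to a cyclic shift and cancel. *)
  under eq_bigr => i _.
    rewrite (_ : \sum_(_ in _ | _) _ =
      (if v i == w then s (v i) else 0) -
      (if v (ordS i) == w then s (v (ordS i)) else 0)); first over.
    rewrite big_mkcond (bigD1 (c i)) //= big1 => [|e eci]; last first.
      by rewrite eq_sym (negPf eci) andbF.
    rewrite eqxx andbT addr0 !inE ends_c !inE ![w == _]eq_sym sS.
    have [iw|_] := eqVneq (v i) w; have [Sw|_] := eqVneq (v (ordS i)) w.
    + by have := sides i; rewrite iw Sw; case: (w \in A).
    + by rewrite subr0.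
    + by rewrite opprK add0r.
    + by rewrite subr0.
  rewrite sumrB [X in X - _](reindex_inj (@ordS_inj _)) /=.
  exact: subrr.
- move=> i; rewrite (big_pred1 i) => [|k]; last by rewrite /= (inj_eq c_inj).
  by rewrite /s; case: ifP; rewrite ?normrN normr1.
- move=> e ce; rewrite big_pred0 // => i; apply: contraNF ce => /eqP<-.
  exact: codom_f.
Qed.

Lemma vertex_forest (R : realType) (V E : finType) (G : multigraph V E)
    (b : {ffun V -> R}) (u : {ffun E -> R^o}) :
  bipartite G -> polytope_vertex (bmatching_polytope G b) u -> forest (gr G u).
Proof.
move=> bipG [[u_ge0 u_sum] u_ext] n v c [v_inj c_inj ends_c].
have cycG : is_cycle G v (val \o c).
  by split=> //; apply: inj_comp c_inj; exact: val_inj.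
have [d [d_sum d1 d0]] := cycle_circulation R bipG cycG.
have [eps eps_gt0 eps_le] :
    exists2 eps : R, 0 < eps & forall i, eps <= u (val (c i)).
  (* The minimum of [u] on the cycle, capped at 1. *)
  exists (\big[Num.min/1]_i u (val (c i))).
    by apply: lt_bigmin => // i _; exact: (valP (c i)).
  by move=> i; exact: bigmin_le_cond.
have perturbP (a : R) : `|a| = eps ->
    bmatching_polytope G b [ffun e => u e + a * d e].
  move=> aE; split=> [e|w].
    rewrite ffunE; have [/codomP[i ->]|ce] := boolP (e \in codom (val \o c)).
      have : `|a * d (val (c i))| <= u (val (c i)).
        by rewrite normrM aE [`|_|]d1 mulr1.
      by rewrite ler_norml => /andP[+ _]; rewrite -subr_ge0 opprK addrC.
    by rewrite d0 // mulr0 addr0.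
  under eq_bigr do rewrite ffunE.
  by rewrite big_split /= u_sum -mulr_sumr d_sum mulr0 addr0.
have half : 0 < (2^-1 : R) < 1 by lra.
have [|||/ffunP/(_ (val (c ord0))) + _] :=
    u_ext _ _ _ (perturbP eps _) (perturbP (- eps) _) half.
- by rewrite gtr0_norm.
- by rewrite normrN gtr0_norm.
- by apply/ffunP => e; rewrite !ffunE /GRing.scale /=; lra.
- rewrite ffunE => /eqP; rewrite -subr_eq0 addrAC subrr add0r mulf_eq0.
  rewrite gt_eqF //= => /eqP dc; have := d1 ord0.
  by rewrite /= dc normr0 => /eqP; rewrite eq_sym oner_eq0.
Qed.

Lemma forest_circulation_eq0 (R : realType) (V E : finType)
    (G : multigraph V E) (u : {ffun E -> R^o}) (d : E -> R) :
  forest (gr G u) -> (forall e, d e != 0 -> 0 < u e) ->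
  (forall v, \sum_(e in incident_edges G v) d e = 0) -> forall e, d e = 0.
Proof.
move=> forest_u d_supp d_sum e; apply/eqP/negPn/negP => de.
pose F := [set f : {e : E | 0 < u e} | d (val f) != 0].
have F0 : F != finset.set0.
  by apply/finset.set0Pn; exists (exist _ e (d_supp e de)); rewrite inE.
have [v [f vf]] := forest_leaf forest_u F0.
have := set11 f; rewrite -vf !inE => /andP[fv /negP]; apply.
apply/eqP; have := d_sum v; rewrite (bigD1 (val f)) ?inE //= big1 ?addr0 // => g.
(* Any other edge at [v] with [d] nonzero would lie in gr(u) and in [F], contradicting that [f] is
   the only one. *)
rewrite inE => /andP[gv gf]; apply/eqP/negPn/negP => dg.
have : exist _ g (d_supp g dg) \in incident_edges (gr G u) v :&: F.
  by rewrite !inE gv.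
by rewrite vf inE => /eqP gE; rewrite -gE eqxx in gf.
Qed.

Lemma forest_vertex (R : realType) (V E : finType) (G : multigraph V E)
    (b : {ffun V -> R}) (u : {ffun E -> R^o}) :
  bmatching_polytope G b u -> forest (gr G u) ->
  polytope_vertex (bmatching_polytope G b) u.
Proof.
move=> Pu forest_u; split=> // x y t Px Py /andP[t0 t1] uE.
(* Stated for any [z], so that it serves both [x] and [y]. *)
have onF (z : {ffun E -> R^o}) : (forall e, u e = 0 -> z e = 0) ->
    bmatching_polytope G b z -> z = u.
  move=> z_supp [_ z_sum]; apply/ffunP => e; apply/eqP; rewrite -subr_eq0.
  apply/eqP; move: e.
  apply: (forest_circulation_eq0 (u := u) (d := fun e => z e - u e)) => // [e|v].
    apply: contraNT; rewrite -leNgt => ue.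
    have ue0 : u e = 0 by apply/eqP; rewrite eq_le ue Pu.1.
    by rewrite ue0 (z_supp e ue0) subr0.
  by rewrite sumrB z_sum Pu.2 subrr.
have uEe e : u e = t * x e + (1 - t) * y e.
  by rewrite {1}uE !ffunE.
(* Where [u] vanishes, two nonnegative terms with positive weights sum to 0, so [x] and [y] vanish
   too. *)
split; apply: onF => // e ue0; have := uEe e; rewrite ue0 => /esym/eqP;
  (rewrite paddr_eq0 ?mulr_ge0 ?Px.1 ?Py.1 //; try lra);
  rewrite !mulf_eq0 subr_eq0 (gt_eqF t0) (gt_eqF t1) /=;
  by case/andP=> /eqP ? /eqP.
Qed.

Unset Implicit Arguments.
Set Strict Implicit.

Theorem corollary23 (R : realType) (V E : finType) (G : multigraph V E)
    (hV : (0 < #|V|)%N) (hG : bipartite G)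
    (b : {ffun V -> R}) (hb : forall v : V, 0 <= b v)
    (u : {ffun E -> R^o}) (hu : bmatching_polytope G b u) :
  polytope_vertex (bmatching_polytope G b) u <-> forest (gr G u).
Proof. by split; [exact: vertex_forest | exact: forest_vertex]. Qed.
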